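(* Let $G$ be a finite, simple, connected, bipartite graph with $|V(G)|>1$ and bipartition $V(G)=A_G\cup B_G$. Let $X\in\{A_G,B_G\}$ and let $D$ be a minimum dominating set of $G$. Let $H$ be any finite, simple graph. Write $\delta^\ast(X)=|D\cap X|/|X|$. If $\delta^\ast(X)>\delta(H)$, then $$\gamma(G\square H)+(\delta(H)|X|+1)\,|V(H)|\ \ge\ \gamma(G)\gamma(H).$$
   Context: $\gamma(G)$ is the domination number of $G$, i.e. the minimum cardinality of a dominating set of $G$ (a set $D\subseteq V(G)$ such that every vertex is in $D$ or adjacent to a vertex of $D$). A minimum dominating set is a dominating set of cardinality $\gamma(G)$. $G\square H$ is the Cartesian product of the graphs $G$ and $H$. The domination density is $\delta(G):=\gamma(G)/|V(G)|$ (so $\delta$ does not denote minimum degree). *)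

(* Defs.v *)
From mathcomp Require Import all_boot all_order all_algebra.

Set Implicit Arguments.
Unset Strict Implicit.
Unset Printing Implicit Defensive.

Import Order.TTheory GRing.Theory Num.Theory.

Structure sgraph := SGraph {
  vertex :> finType;
  adj : rel vertex;
  adj_sym : symmetric adj;
  adj_irrefl : irreflexive adj
}.

Definition connected_graph (G : sgraph) : Prop :=
  forall x y : G, connect (@adj G) x y.

Definition independent (G : sgraph) (S : {set G}) : bool :=
  [forall x in S, forall y in S, ~~ adj x y].

Definition bipartition (G : sgraph) (A B : {set G}) : bool :=
  [&& A :|: B == [set: G], [disjoint A & B], independent A & independent B].

Definition dominating (G : sgraph) (D : {set G}) : bool :=
  [forall v : G, (v \in D) || [exists u in D, adj u v]].

(* The default value [set: G] is always dominating, see dominatingT. *)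
Definition domination_number (G : sgraph) : nat :=
  #|[arg min_(D < [set: G] | dominating D) #|D| ]|.

Definition min_dominating (G : sgraph) (D : {set G}) : bool :=
  dominating D && (#|D| == domination_number G).

Lemma dominatingT (G : sgraph) : dominating [set: G].
Proof. by apply/forallP => v; rewrite inE. Qed.

Lemma domination_number_le (G : sgraph) (D : {set G}) :
  dominating D -> domination_number G <= #|D|.
Proof.
rewrite /domination_number; case: arg_minnP; first exact: dominatingT.
by move=> D0 _ minD0; exact: minD0.
Qed.

Lemma domination_number_ex (G : sgraph) :
  exists D : {set G}, min_dominating D.
Proof.
exists [arg min_(D < [set: G] | dominating D) #|D| ].
rewrite /min_dominating eqxx andbT.
by case: arg_minnP => //; exact: dominatingT.
Qed.

(* On the graph without vertices this is 0 / 0 = 0. *)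
Definition domination_density (G : sgraph) : rat :=
  ((domination_number G)%:R / #|G|%:R)%R.

Definition relative_density (G : sgraph) (D X : {set G}) : rat :=
  (#|D :&: X|%:R / #|X|%:R)%R.

Section CartesianProduct.
Variables G H : sgraph.

Definition cart_adj : rel (G * H)%type := fun p q =>
  (p.1 == q.1) && adj p.2 q.2 || (p.2 == q.2) && adj p.1 q.1.

Lemma cart_adj_sym : symmetric cart_adj.
Proof.
move=> p q; rewrite /cart_adj (eq_sym p.1) (eq_sym p.2).
by rewrite (adj_sym p.1) (adj_sym p.2).
Qed.

Lemma cart_adj_irrefl : irreflexive cart_adj.
Proof. by move=> p; rewrite /cart_adj !adj_irrefl !andbF. Qed.

Definition cart_prod : sgraph := SGraph cart_adj_sym cart_adj_irrefl.

End CartesianProduct.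

(* Main.v *)
Require Import Defs.
From mathcomp Require Import all_boot all_order all_algebra.

(** In a connected graph with at least two vertices every vertex has a
    neighbour, and in a bipartite graph that neighbour lies on the opposite
    side.  Hence each side [X] of the bipartition dominates [G], which gives
    [gamma(G) <= |X|] ([domination_number_le_part]).  On the other hand
    [delta(H) |V(H)| = gamma(H)] ([domination_densityM]), so the correction
    term on the right-hand side already contains
    [delta(H) |X| |V(H)| = |X| gamma(H) >= gamma(G) gamma(H)]; the remaining
    terms [gamma(G \square H)] and [|V(H)|] are nonnegative. *)

Import Order.TTheory GRing.Theory Num.Theory.

Lemma connected_has_neighbour (G : sgraph) (v : G) :
  connected_graph G -> 1 < #|G| -> exists u, adj u v.
Proof.
move=> G_conn; rewrite (cardD1 v) inE ltnS => /card_gt0P[w].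
rewrite !inE andbT => w_neq_v.
have /connectP[[|u p] /= path_vw w_last] := G_conn v w.
  by rewrite w_last eqxx in w_neq_v.
by case/andP: path_vw => adj_vu _; exists u; rewrite adj_sym.
Qed.

Lemma bipartitionC (G : sgraph) (A B : {set G}) :
  bipartition A B = bipartition B A.
Proof.
by rewrite /bipartition setUC disjoint_sym (andbC (independent A)).
Qed.

Lemma bipartition_dominating (G : sgraph) (A B : {set G}) :
  connected_graph G -> 1 < #|G| -> bipartition A B -> dominating A.
Proof.
move=> G_conn G_gt1 /and3P[/eqP cover_AB _ /andP[_ indepB]].
have mem_AB x : (x \in A) || (x \in B) by rewrite -in_setU cover_AB inE.
apply/forallP => v; case/orP: (mem_AB v) => [-> // | vB].
have [u adj_uv] := connected_has_neighbour G v G_conn G_gt1.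
apply/orP; right; apply/existsP; exists u; rewrite adj_uv andbT.
case/orP: (mem_AB u) => // uB.
by have /forall_inP/(_ u uB)/forall_inP/(_ v vB) := indepB; rewrite adj_uv.
Qed.

Lemma domination_number_le_part (G : sgraph) (A B X : {set G}) :
    connected_graph G -> 1 < #|G| -> bipartition A B -> X = A \/ X = B ->
  domination_number G <= #|X|.
Proof.
move=> G_conn G_gt1 bipAB X_part; apply: domination_number_le.
case: X_part => ->; first exact: bipartition_dominating bipAB.
by apply: (bipartition_dominating G B A) => //; rewrite bipartitionC.
Qed.

Lemma domination_densityM (H : sgraph) :
  (domination_density H * #|H|%:R = (domination_number H)%:R)%R.
Proof.
have [H0 | H_neq0] := eqVneq #|H| 0; last by rewrite divfK // pnatr_eq0.
(* Without vertices the density is the junk value 0, but so is gamma(H). *)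
have := domination_number_le (dominatingT H).
by rewrite cardsT H0 leqn0 => /eqP->; rewrite mulr0.
Qed.

Theorem corollary1 (G : sgraph) (A_G B_G X D : {set G}) (H : sgraph)
  (G_connected : connected_graph G)
  (G_nontrivial : (1 < #|G|)%N)
  (G_bipartite : bipartition A_G B_G)
  (X_part : X = A_G \/ X = B_G)
  (D_min : min_dominating D)
  (density_lt : (domination_density H < relative_density D X)%R) :
  ((domination_number G)%:R * (domination_number H)%:R
   <= (domination_number (cart_prod G H))%:R
      + (domination_density H * #|X|%:R + 1) * #|H|%:R :> rat)%R.
Proof.
have gamma_le : domination_number G <= #|X|.
  exact: domination_number_le_part G_bipartite X_part.
rewrite mulrDl mul1r mulrAC domination_densityM -!natrM -!natrD ler_nat.
rewrite mulnC addnCA; apply: leq_trans (leq_addr _ _).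
by rewrite leq_mul2l gamma_le orbT.
Qed.
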